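(* Let $\lambda\in\mathbb{C}$ with $\operatorname{Re}\lambda\in[0,\tfrac12]$ and $|\operatorname{Im}\lambda|\le 10$. Then there is no unstable mode for $\lambda$, i.e. there is no nontrivial (not identically zero) complex-valued function $u_\lambda\in C^\infty[0,1]$ satisfying $$-(1-\rho^2)u_\lambda''(\rho)-2\frac{1-\rho^2}{\rho}u_\lambda'(\rho)+2\lambda\rho\, u_\lambda'(\rho)+\lambda(\lambda+1)u_\lambda(\rho)+\frac{V(\rho)}{\rho^2}u_\lambda(\rho)=0\qquad\text{for }\rho\in(0,1),$$ where $V(\rho)=2\cos(4\arctan\rho)=\frac{2(1-6\rho^2+\rho^4)}{(1+\rho^2)^2}$.
   Context: An unstable mode for $\lambda\in\mathbb{C}$ with $\operatorname{Re}\lambda\ge0$ is a nontrivial solution $u_\lambda\in C^\infty[0,1]$ of the ODE in the claim. $C^\infty[0,1]$ denotes complex-valued functions smooth up to and including the endpoints. *)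

(* Defs.v *)
From Stdlib Require Import Reals Lra.
From Coquelicot Require Import Coquelicot.
Open Scope R_scope.

Definition unit_interval (x : R) : Prop := 0 <= x <= 1.

(* Differentiability relative to [0,1]: two-sided in the interior, one-sided
   at the endpoints, so the values of [f] outside [0,1] play no role. *)
Definition is_derive01 (f : R -> C) (x : R) (l : C) : Prop :=
  @filterdiff R_AbsRing R_NormedModule C_R_NormedModule f
    (within unit_interval (locally x)) (fun y : R => scal y l).

Definition smooth01 (f : R -> C) : Prop :=
  exists D : nat -> R -> C,
    (forall x, unit_interval x -> D 0%nat x = f x) /\
    (forall n x, unit_interval x -> is_derive01 (D n) x (D (S n) x)).

(* Coquelicot's [Derive_n] is real-valued, so it is taken on the real and
   imaginary parts. *)
Definition CDerive_n (f : R -> C) (n : nat) (x : R) : C :=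
  (Derive_n (fun t => Re (f t)) n x, Derive_n (fun t => Im (f t)) n x).

Definition V (rho : R) : R := 2 * cos (4 * atan rho).

Lemma V_rational (rho : R) :
  V rho = 2 * (1 - 6 * rho ^ 2 + rho ^ 4) / (1 + rho ^ 2) ^ 2.
Proof.
unfold V.
assert (H : 0 < 1 + rho ^ 2) by (pose proof (pow2_ge_0 rho); lra).
assert (Hc : cos (2 * atan rho) = 2 / (1 + rho ^ 2) - 1).
{ rewrite cos_2a_cos, cos_atan.
  replace (rho²) with (rho ^ 2) by (unfold Rsqr; ring).
  pose proof (sqrt_lt_R0 _ H) as Hs.
  pose proof (sqrt_sqrt (1 + rho ^ 2) (Rlt_le _ _ H)) as Hq.
  rewrite <- Hq at 3. field. lra. }
replace (4 * atan rho) with (2 * (2 * atan rho)) by ring.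
rewrite cos_2a_cos, Hc. field. lra.
Qed.

Definition mode_equation (lam : C) (u : R -> C) (rho : R) : Prop :=
  (- RtoC (1 - rho ^ 2) * CDerive_n u 2 rho
   - RtoC (2 * ((1 - rho ^ 2) / rho)) * CDerive_n u 1 rho
   + RtoC 2 * lam * RtoC rho * CDerive_n u 1 rho
   + lam * (lam + RtoC 1) * u rho
   + RtoC (V rho / rho ^ 2) * u rho = RtoC 0)%C.

Definition unstable_mode (lam : C) (u : R -> C) : Prop :=
  0 <= Re lam /\
  smooth01 u /\
  (exists rho, unit_interval rho /\ u rho <> RtoC 0) /\
  (forall rho, 0 < rho < 1 -> mode_equation lam u rho).

(* Main.v *)
Require Import Defs.
From Stdlib Require Import Reals Lra.
From Coquelicot Require Import Coquelicot.
Open Scope R_scope.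

(** Write [lam = a + i b] and [t = x ^ 2]. A supersymmetric (Darboux) transformation built on the
    explicit mode of [lam = 1] turns a mode [u] into
    [v = (1 - t) (x u' - u (1 - t) / (1 + t)) + (1 - lam) t u], which solves
    [- (1 - t) v'' + 2 lam x v' + lam (lam - 1) v + (6 / t - 8 / (1 + t)) v = 0]
    and vanishes only if [u] does. Here [6 / t] is the centrifugal barrier of angular momentum 2;
    [y = v' + 2 v / x] lowers it to angular momentum 1 and solves an equation of the same type with
    [lam] replaced by [lam + 1] and a source term [- 16 x / (1 + t) ^ 2 * v].
    The wave energy of [y] scales like [tau ^ (- 1 - 2 a)] in the time [tau] to blowup, so its
    density enters the derivative of the flux with the positive weight [1 + 2 a]. Corrected by multiples of [|y| ^ 2] and [|v| ^ 2], the energy flux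
    through the cone is nondecreasing on (0,1), tends to 0 at the centre because [v] vanishes there
    to second order, and is nonpositive at the light cone [x = 1]. It is therefore constant, which
    forces [v = 0]. The estimate is uniform in [b]. *)

(** [auto_derive] leaves the derivatives of abstract functions as [Derive] terms. Each hypothesis
    supplies the value of one of them and is then cleared, so that the loop ends. *)
Ltac rewrite_derivatives :=
  repeat match goal with
  | H : is_derive ?f ?x ?l |- _ =>
      try replace (Derive (fun r => f r) x) with l
        by (symmetry; exact (is_derive_unique _ _ _ H));
      clear H
  end.

(** * Energy flux and its dissipation *)

(* The arguments are the real and imaginary parts of [v], [y], [y']; [th] is [x y' + lam y], the
   time derivative of the self-similar wave. The coefficients of the two correction terms are
   chosen so that [dissipation] is a combination of squares with nonnegative weights. *)
Definition energy (a b x v1 v2 y1 y2 z1 z2 : R) : R :=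
  let th1 := x * z1 + (a * y1 - b * y2) in
  let th2 := x * z2 + (a * y2 + b * y1) in
  (z1 * th1 + z2 * th2)
  - x / 2 * (th1 ^ 2 + th2 ^ 2 + z1 ^ 2 + z2 ^ 2
             + (2 / x ^ 2 - 8 / (1 + x ^ 2)) * (y1 ^ 2 + y2 ^ 2))
  - (1 / (2 * x) + x / 2) * (y1 ^ 2 + y2 ^ 2)
  - 8 * x / ((1 + 2 * a) * (1 + x ^ 2) ^ 2) * (v1 ^ 2 + v2 ^ 2).

Definition dissipation (a b x v1 v2 y1 y2 z1 z2 : R) : R :=
  let D := 1 + 2 * a in
  let th1 := x * z1 + (a * y1 - b * y2) in
  let th2 := x * z2 + (a * y2 + b * y1) in
  let s := 16 * x / (1 + x ^ 2) ^ 2 in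
  D / 2 * ((z1 - y1 / (x * D)) ^ 2 + (z2 - y2 / (x * D)) ^ 2)
  + 1 / (2 * D) * ((D * th1 + s * v1 - y1) ^ 2 + (D * th2 + s * v2 - y2) ^ 2)
  + (D / x ^ 2 - 4 * D / (1 + x ^ 2) + 8 / (1 + x ^ 2) ^ 2 + 1 / (2 * x ^ 2)
     - 1 / (2 * D * x ^ 2) + D / 2 - 1 - 1 / (2 * D)) * (y1 ^ 2 + y2 ^ 2)
  + 8 * (3 - 6 * x ^ 2 + 7 * x ^ 4) / (D * (1 + x ^ 2) ^ 4) * (v1 ^ 2 + v2 ^ 2).

(** The uncorrected flux contributes [(1 + 2 * a) / 2] times [|z|^2 + |th|^2] and the source term
    [s v . th]. As [x z = th - lam y], the [|y|^2] correction adds the cross terms [- y . z / x] and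
    [- y . th], which complete the two squares of [dissipation]. The [|v|^2] correction cancels the
    product [v . y] left over by the second square. *)
Lemma is_derive_energy (a b x : R) (v1 v2 y1 y2 z1 z2 : R -> R) (w1 w2 : R) :
  0 <= a -> 0 < x ->
  is_derive v1 x (y1 x - 2 / x * v1 x) -> is_derive v2 x (y2 x - 2 / x * v2 x) ->
  is_derive y1 x (z1 x) -> is_derive y2 x (z2 x) ->
  is_derive z1 x w1 -> is_derive z2 x w2 ->
  (1 - x ^ 2) * w1 = 2 * x * ((a + 1) * z1 x - b * z2 x)
    + ((a ^ 2 - b ^ 2 + a) * y1 x - (2 * a * b + b) * y2 x)
    + (2 / x ^ 2 - 8 / (1 + x ^ 2)) * y1 x + 16 * x / (1 + x ^ 2) ^ 2 * v1 x ->
  (1 - x ^ 2) * w2 = 2 * x * ((a + 1) * z2 x + b * z1 x)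
    + ((a ^ 2 - b ^ 2 + a) * y2 x + (2 * a * b + b) * y1 x)
    + (2 / x ^ 2 - 8 / (1 + x ^ 2)) * y2 x + 16 * x / (1 + x ^ 2) ^ 2 * v2 x ->
  is_derive (fun r => energy a b r (v1 r) (v2 r) (y1 r) (y2 r) (z1 r) (z2 r)) x
    (dissipation a b x (v1 x) (v2 x) (y1 x) (y2 x) (z1 x) (z2 x)).
Proof.
intros Ha Hx Hv1 Hv2 Hy1 Hy2 Hz1 Hz2 E1 E2.
unfold energy.
evar_last.
{ auto_derive; [repeat split;
    first [eexists; eassumption | apply Rgt_not_eq; repeat apply Rmult_lt_0_compat; nra]
    | reflexivity]. }
rewrite_derivatives.
set (th1 := x * z1 x + (a * y1 x - b * y2 x)).
set (th2 := x * z2 x + (a * y2 x + b * y1 x)).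
(* [w1] and [w2] enter only through [(1 - x ^ 2) * w1] and [(1 - x ^ 2) * w2]. *)
match goal with |- ?l = _ =>
  transitivity (l - w1 * (1 - x ^ 2) * th1 - w2 * (1 - x ^ 2) * th2
    + ((1 - x ^ 2) * w1) * th1 + ((1 - x ^ 2) * w2) * th2); [ring|]
end.
rewrite E1, E2. clear E1 E2.
unfold dissipation, th1, th2.
field. repeat split; nra.
Qed.

Lemma dissipation_bound (a b x v1 v2 y1 y2 z1 z2 : R) :
  0 <= a <= 1 / 2 -> 0 < x < 1 ->
  v1 ^ 2 + v2 ^ 2 <= 4 * (1 + 2 * a) * dissipation a b x v1 v2 y1 y2 z1 z2.
Proof.
intros Ha Hx. unfold dissipation. cbv zeta.
set (th1 := x * z1 + (a * y1 - b * y2)).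
set (th2 := x * z2 + (a * y2 + b * y1)).
set (D := 1 + 2 * a).
assert (HD : 1 <= D <= 2) by (unfold D; lra).
assert (Hx2 : 0 < x ^ 2 < 1) by nra.
assert (M : 0 <= D / x ^ 2 - 4 * D / (1 + x ^ 2) + 8 / (1 + x ^ 2) ^ 2 + 1 / (2 * x ^ 2)
     - 1 / (2 * D * x ^ 2) + D / 2 - 1 - 1 / (2 * D)).
{ set (t := x ^ 2) in *. clearbody t D.
  replace (_ - 1 / (2 * D)) with
   ((2 * D ^ 2 * (1 + t) ^ 2 - 8 * D ^ 2 * t * (1 + t) + 16 * D * t
     + (D - 1) * (1 + t) ^ 2 + (D ^ 2 - 2 * D - 1) * t * (1 + t) ^ 2)
    / (2 * D * t * (1 + t) ^ 2)) by (field; nra).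
  apply Rdiv_le_0_compat; [|repeat apply Rmult_lt_0_compat; nra].
  (* The numerator is quadratic in [D] and is interpolated between its values
     [2 (1 - t) (1 + 6 t + t^2)] at [D = 1] and [(1 - t) (9 + 26 t + t^2)] at [D = 2]. The remainder
     is [(D - 1) (2 - D)] times [- 2 (1 - t) + (t + 4 t^2 - t^3)]; its negative part is absorbed
     into the term [2 (2 - D)^2]. *)
  assert (0 <= (1 - t) * ((2 - D) * (6 * t + t ^ 2) * 2 + (D - 1) * (9 + 26 * t + t ^ 2)
                + 2 * (2 - D) ^ 2)).
  { apply Rmult_le_pos; [lra|].
    assert (0 <= (2 - D) * (6 * t + t ^ 2)) by (apply Rmult_le_pos; nra).
    assert (0 <= (D - 1) * (9 + 26 * t + t ^ 2)) by (apply Rmult_le_pos; nra).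
    nra. }
  assert (0 <= (D - 1) * (2 - D) * (t + 4 * t ^ 2 - t ^ 3)).
  { apply Rmult_le_pos; [nra|]. nra. }
  nra. }
assert (0 <= D / 2 * ((z1 - y1 / (x * D)) ^ 2 + (z2 - y2 / (x * D)) ^ 2)).
{ apply Rmult_le_pos; [lra|]. apply Rplus_le_le_0_compat; apply pow2_ge_0. }
assert (0 <= 1 / (2 * D) * ((D * th1 + 16 * x / (1 + x ^ 2) ^ 2 * v1 - y1) ^ 2 +
     (D * th2 + 16 * x / (1 + x ^ 2) ^ 2 * v2 - y2) ^ 2)).
{ apply Rmult_le_pos; [apply Rdiv_le_0_compat; lra|]. apply Rplus_le_le_0_compat; apply pow2_ge_0. }
pose proof (Rmult_le_pos _ (y1 ^ 2 + y2 ^ 2) M ltac:(apply Rplus_le_le_0_compat; apply pow2_ge_0)).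
set (K := 8 * (3 - 6 * x ^ 2 + 7 * x ^ 4) / (D * (1 + x ^ 2) ^ 4)).
(* The quadratic [3 - 6 t + 7 t^2] is at least [12 / 7] and [(1 + t)^4 <= 16], so the factor 4
   leaves ample room. *)
assert (HK : 1 <= 4 * D * K).
{ replace (4 * D * K) with (32 * (3 - 6 * x ^ 2 + 7 * (x ^ 2) ^ 2) / (1 + x ^ 2) ^ 4)
    by (unfold K; field; nra).
  set (t := x ^ 2) in *. clearbody t.
  apply Rle_div_r; [apply pow_lt; lra|].
  assert ((1 + t) ^ 2 <= 4) by nra.
  assert (0 <= (1 + t) ^ 2) by nra.
  replace ((1 + t) ^ 4) with ((1 + t) ^ 2 * (1 + t) ^ 2) by ring. nra. }
assert (Hv : 0 <= v1 ^ 2 + v2 ^ 2) by (apply Rplus_le_le_0_compat; apply pow2_ge_0).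
apply Rle_trans with (4 * D * (K * (v1 ^ 2 + v2 ^ 2))); [nra|].
apply Rmult_le_compat_l; [lra|]. lra.
Qed.

(** * The equation for [v] and the equation it implies for [y] *)

(* The real part of the equation for [v = p + i q]; the imaginary part is the same relation for
   [- i v], that is, with [(q, - p)] in place of [(p, q)]. *)
Definition repulsive_eq (a b x p0 p1 p2 q0 q1 : R) : Prop :=
  - (1 - x ^ 2) * p2 + 2 * x * (a * p1 - b * q1)
  + ((a ^ 2 - b ^ 2 - a) * p0 - (2 * a * b - b) * q0)
  + (6 / x ^ 2 - 8 / (1 + x ^ 2)) * p0 = 0.

(** Allows an equation valid on (0,1) to be differentiated: with [f] its left-hand side, [l = 0] is
    the differentiated equation. *)
Lemma is_derive_zero (f : R -> R) (x l : R) :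
  0 < x < 1 -> (forall y, 0 < y < 1 -> f y = 0) -> is_derive f x l -> l = 0.
Proof.
intros Hx Hf Hl.
rewrite <- (is_derive_unique _ _ _ Hl), <- (Derive_const 0 x).
apply Derive_ext_loc.
apply (locally_interval _ x 0 1); simpl; try lra.
intros y H0 H1. now apply Hf.
Qed.

(** The equation for [y = v' + 2 v / x] is minus the operator [d/dx + 2 / x] applied to the equation
    for [v]; the source term is the derivative of the potential [- 8 / (1 + x ^ 2)]. *)
Lemma intertwined_eq (a b : R) (p0 p1 p2 p3 q0 q1 q2 : R -> R) (x : R) :
  0 < x < 1 ->
  is_derive p0 x (p1 x) -> is_derive p1 x (p2 x) -> is_derive p2 x (p3 x) ->
  is_derive q0 x (q1 x) -> is_derive q1 x (q2 x) ->
  (forall r, 0 < r < 1 ->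
    repulsive_eq a b r (p0 r) (p1 r) (p2 r) (q0 r) (q1 r)) ->
  (1 - x ^ 2) * (p3 x + 2 / x * p2 x - 4 / x ^ 2 * p1 x + 4 / x ^ 3 * p0 x)
  = 2 * x * ((a + 1) * (p2 x + 2 / x * p1 x - 2 / x ^ 2 * p0 x)
             - b * (q2 x + 2 / x * q1 x - 2 / x ^ 2 * q0 x))
    + ((a ^ 2 - b ^ 2 + a) * (p1 x + 2 / x * p0 x)
       - (2 * a * b + b) * (q1 x + 2 / x * q0 x))
    + (2 / x ^ 2 - 8 / (1 + x ^ 2)) * (p1 x + 2 / x * p0 x)
    + 16 * x / (1 + x ^ 2) ^ 2 * p0 x.
Proof.
intros Hx Hp0 Hp1 Hp2 Hq0 Hq1 E.
assert (E' : - (1 - x ^ 2) * p3 x + 2 * x * p2 x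
   + 2 * (a * p1 x - b * q1 x) + 2 * x * (a * p2 x - b * q2 x)
   + ((a ^ 2 - b ^ 2 - a) * p1 x - (2 * a * b - b) * q1 x)
   + (6 / x ^ 2 - 8 / (1 + x ^ 2)) * p1 x
   + (16 * x / (1 + x ^ 2) ^ 2 - 12 / x ^ 3) * p0 x = 0).
{ apply (is_derive_zero _ x _ Hx E).
  evar_last.
  { auto_derive; [repeat split;
      first [eexists; eassumption | apply Rgt_not_eq; nra] | reflexivity]. }
  rewrite_derivatives.
  field. split; nra. }
specialize (E x Hx). unfold repulsive_eq in E.
apply Rminus_diag_uniq.
rewrite <- (Rmult_0_r (- 2 / x)), <- E, <- (Rminus_0_r (- 2 / x * _)), <- E'.
field. split; nra.
Qed.

(** * Monotonicity and bounds on closed intervals *)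

Lemma nondecreasing_of_derive (f f' : R -> R) (x y : R) :
  x <= y ->
  (forall r, x < r < y -> is_derive f r (f' r) /\ 0 <= f' r) ->
  (forall r, x <= r <= y -> continuous f r) ->
  f x <= f y.
Proof.
intros Hxy Hd Hc.
(* [MVT_gen] may return an endpoint, where nothing is known about [f']; hence the absolute value. *)
destruct (MVT_gen f x y (fun r => Rabs (f' r))) as [c [_ Hc']].
- rewrite Rmin_left, Rmax_right by lra.
  intros r Hr. destruct (Hd r Hr) as [Hr' H0]. now rewrite Rabs_pos_eq.
- rewrite Rmin_left, Rmax_right by lra.
  intros r Hr. now apply continuity_pt_filterlim, Hc.
- pose proof (Rabs_pos (f' c)). nra.
Qed.

Lemma le_of_derive_bound (f f' : R -> R) (M x : R) :
  0 <= x <= 1 -> f 0 = 0 ->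
  (forall r, 0 < r < 1 -> is_derive f r (f' r)) ->
  (forall r, 0 <= r <= 1 -> continuous f r) ->
  (forall r, 0 <= r <= x -> Rabs (f' r) <= M) ->
  Rabs (f x) <= M * x.
Proof.
intros Hx H0 Hd Hc HM.
destruct (MVT_gen f 0 x f') as [c [Hc1 Hc2]].
- rewrite Rmin_left, Rmax_right by lra. intros r Hr. apply Hd. lra.
- rewrite Rmin_left, Rmax_right by lra.
  intros r Hr. apply continuity_pt_filterlim, Hc. lra.
- rewrite Rmin_left, Rmax_right in Hc1 by lra.
  replace (f x) with (f' c * x) by lra.
  rewrite Rabs_mult, (Rabs_pos_eq x) by lra.
  apply Rmult_le_compat_r; [lra|]. now apply HM.
Qed.

Lemma bounded_unit (f : R -> R) :
  (forall x, 0 <= x <= 1 -> continuous f x) ->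
  exists M, forall x, 0 <= x <= 1 -> Rabs (f x) <= M.
Proof.
intros Hf.
destruct (continuity_ab_maj (fun x => Rabs (f x)) 0 1) as [m [Hm _]]; [lra| |].
- intros c Hc. apply continuity_pt_filterlim.
  now apply (continuous_Rabs_comp f), Hf.
- now exists (Rabs (f m)).
Qed.

(** The eta-reduced forms [Rmult c] and [Rdiv c] are expanded again so that the product rule
    applies. The goals left over are the nonvanishing of denominators. *)
Ltac prove_continuous :=
  repeat first
    [ assumption
    | apply continuous_const
    | apply continuous_id
    | match goal with
      | |- continuous (Rmult ?c) ?x => change (continuous (fun r => c * r) x)
      | |- continuous (Rdiv ?c) ?x => change (continuous (fun r => c * / r) x)
      | |- continuous Rinv _ => apply continuous_Rinv
      | |- continuous (fun r => _ + _) _ => apply (continuous_plus (V := R_NormedModule))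
      | |- continuous (fun r => _ - _) _ => apply (continuous_minus (V := R_NormedModule))
      | |- continuous (fun r => - _) _ => apply (continuous_opp (V := R_NormedModule))
      | |- continuous (fun r => _ * _) _ => apply (continuous_mult (K := R_AbsRing))
      | |- continuous (fun r => _ / _) _ => apply (continuous_mult (K := R_AbsRing))
      | |- continuous (fun r => / _) _ => apply continuous_Rinv_comp
      end ].

(** * The energy at the light cone and near the centre *)

Lemma continuous_energy (a b x : R) (v1 v2 y1 y2 z1 z2 : R -> R) :
  0 <= a -> 0 < x ->
  continuous v1 x -> continuous v2 x -> continuous y1 x -> continuous y2 x ->
  continuous z1 x -> continuous z2 x ->
  continuous (fun r => energy a b r (v1 r) (v2 r) (y1 r) (y2 r) (z1 r) (z2 r)) x.
Proof.
intros Ha Hx. intros. unfold energy; simpl pow.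
prove_continuous; apply Rgt_not_eq; repeat apply Rmult_lt_0_compat; nra.
Qed.

(** At [x = 1], [z . th - (|th|^2 + |z|^2) / 2 = - |th - z|^2 / 2 = - |lam y|^2 / 2]. The potential
    equals [2 - 4 = - 2] there and contributes [+ |y|^2], which the [|y|^2] correction cancels
    exactly. *)
Lemma energy_at_1 (a b v1 v2 y1 y2 z1 z2 : R) :
  0 <= a -> energy a b 1 v1 v2 y1 y2 z1 z2 <= 0.
Proof.
intros Ha. unfold energy.
replace (_ - _) with
  (- (((a ^ 2 + b ^ 2) * (y1 ^ 2 + y2 ^ 2)) / 2
      + 2 / (1 + 2 * a) * (v1 ^ 2 + v2 ^ 2))) by (field; lra).
assert (0 <= 2 / (1 + 2 * a)) by (apply Rdiv_le_0_compat; lra).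
assert (0 <= v1 ^ 2 + v2 ^ 2) by nra.
assert (0 <= (a ^ 2 + b ^ 2) * (y1 ^ 2 + y2 ^ 2)) by (apply Rmult_le_pos; nra).
nra.
Qed.

(** Every term is of order [x]: [th] is, which handles the products with [z], and the singular
    coefficients of size [1 / x] multiply [|y|^2], of order [x ^ 2]. *)
Lemma energy_near_0 (a b M x v1 v2 y1 y2 z1 z2 : R) :
  0 <= a <= 1 / 2 -> 0 < x < 1 ->
  Rabs v1 <= M * x -> Rabs v2 <= M * x -> Rabs y1 <= M * x -> Rabs y2 <= M * x ->
  Rabs z1 <= M -> Rabs z2 <= M ->
  - (7 + Rabs b) ^ 2 * M ^ 2 * x <= energy a b x v1 v2 y1 y2 z1 z2.
Proof.
intros Ha Hx Hv1 Hv2 Hy1 Hy2 Hz1 Hz2.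
pose proof (Rabs_pos b) as Hb.
assert (HM : 0 <= M) by (pose proof (Rabs_pos z1); lra).
assert (sq : forall c N, Rabs c <= N -> c ^ 2 <= N ^ 2).
{ intros c N Hc. rewrite <- (pow2_abs c). pose proof (Rabs_pos c). nra. }
assert (Hxz : forall z, Rabs z <= M -> Rabs (x * z) <= M * x).
{ intros z Hz. rewrite Rabs_mult, (Rabs_pos_eq x) by lra. nra. }
assert (Hay : forall y, Rabs y <= M * x -> Rabs (a * y) <= M * x).
{ intros y Hy. rewrite Rabs_mult, (Rabs_pos_eq a) by lra. pose proof (Rabs_pos y). nra. }
assert (Hby : forall y, Rabs y <= M * x -> Rabs (b * y) <= Rabs b * (M * x)).
{ intros y Hy. rewrite Rabs_mult. now apply Rmult_le_compat_l. }
unfold energy. cbv zeta.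
set (th1 := x * z1 + (a * y1 - b * y2)).
set (th2 := x * z2 + (a * y2 + b * y1)).
set (L := 2 + Rabs b).
assert (Hth1 : Rabs th1 <= L * (M * x)).
{ unfold th1, L. specialize (Hxz _ Hz1). specialize (Hay _ Hy1). specialize (Hby _ Hy2).
  apply Rabs_le_between in Hxz, Hay, Hby. apply Rabs_le_between. lra. }
assert (Hth2 : Rabs th2 <= L * (M * x)).
{ unfold th2, L. specialize (Hxz _ Hz2). specialize (Hay _ Hy2). specialize (Hby _ Hy1).
  apply Rabs_le_between in Hxz, Hay, Hby. apply Rabs_le_between. lra. }
clearbody th1 th2.
assert (prod : forall z th, Rabs z <= M -> Rabs th <= L * (M * x) -> - (L * M ^ 2 * x) <= z * th).
{ intros z th Hz Hth.
  assert (Rabs (z * th) <= M * (L * (M * x))).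
  { rewrite Rabs_mult. apply Rmult_le_compat; auto using Rabs_pos. }
  apply Rabs_le_between in H. nra. }
pose proof (prod _ _ Hz1 Hth1). pose proof (prod _ _ Hz2 Hth2).
apply sq in Hv1, Hv2, Hy1, Hy2, Hz1, Hz2, Hth1, Hth2.
set (W := M ^ 2 * x).
assert (HW : 0 <= W) by (unfold W; apply Rmult_le_pos; nra).
assert (HL : 2 <= L) by (unfold L; lra).
assert (T1 : x / 2 * (th1 ^ 2 + th2 ^ 2 + z1 ^ 2 + z2 ^ 2) <= (L ^ 2 + 1) * W).
{ assert (th1 ^ 2 + th2 ^ 2 <= 2 * (L ^ 2 * M ^ 2)).
  { assert (L ^ 2 * M ^ 2 * x ^ 2 <= L ^ 2 * M ^ 2 * 1).
    { apply Rmult_le_compat_l; [apply Rmult_le_pos; nra|nra]. }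
    nra. }
  unfold W. nra. }
assert (Y : y1 ^ 2 + y2 ^ 2 <= 2 * x * W) by (unfold W; nra).
assert (HY : 0 <= y1 ^ 2 + y2 ^ 2) by nra.
assert (U : v1 ^ 2 + v2 ^ 2 <= 2 * x * W) by (unfold W; nra).
assert (HU : 0 <= v1 ^ 2 + v2 ^ 2) by nra.
assert (Y' : / x * (y1 ^ 2 + y2 ^ 2) <= 2 * W).
{ apply (Rmult_le_reg_l x); [lra|]. rewrite <- Rmult_assoc, Rinv_r by lra. lra. }
set (Y2 := y1 ^ 2 + y2 ^ 2) in *. set (U2 := v1 ^ 2 + v2 ^ 2) in *.
assert (T2 : x / 2 * ((2 / x ^ 2 - 8 / (1 + x ^ 2)) * Y2) <= 2 * W).
{ replace (x / 2 * _) with (/ x * Y2 - 4 * x / (1 + x ^ 2) * Y2) by (field; nra).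
  assert (0 <= 4 * x / (1 + x ^ 2) * Y2).
  { apply Rmult_le_pos; [apply Rdiv_le_0_compat; nra|lra]. }
  lra. }
assert (T3 : (1 / (2 * x) + x / 2) * Y2 <= 2 * W).
{ replace (_ * Y2) with (/ x * Y2 - (/ x - x) / 2 * Y2) by (field; lra).
  assert (1 <= / x) by (rewrite <- Rinv_1; apply Rinv_le_contravar; lra).
  assert (0 <= (/ x - x) / 2 * Y2) by (apply Rmult_le_pos; lra).
  lra. }
assert (T4 : 8 * x / ((1 + 2 * a) * (1 + x ^ 2) ^ 2) * U2 <= 16 * W).
{ assert (8 * x / ((1 + 2 * a) * (1 + x ^ 2) ^ 2) <= 8).
  { apply Rle_div_l; [apply Rmult_lt_0_compat; nra|].
    assert (1 <= (1 + 2 * a) * (1 + x ^ 2) ^ 2).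
    { rewrite <- (Rmult_1_l 1) at 1. apply Rmult_le_compat; nra. }
    nra. }
  apply (Rle_trans _ (8 * U2)); [apply Rmult_le_compat_r; lra|nra]. }
(* The bounds add up to [(L ^ 2 + 2 * L + 21) * W], which is below [(L + 5) ^ 2 * W]. *)
replace (7 + Rabs b) with (L + 5) by (unfold L; ring).
replace (- (L + 5) ^ 2 * M ^ 2 * x) with (- ((L + 5) ^ 2 * W)) by (unfold W; ring).
unfold W in *. nra.
Qed.

(** * Vanishing of [v] *)

Lemma repulsive_mode_trivial (a b : R) (p0 p1 p2 p3 q0 q1 q2 q3 : R -> R) :
  0 <= a <= 1 / 2 ->
  (forall x, 0 <= x <= 1 -> continuous p0 x /\ continuous p1 x /\ continuous p2 x) ->
  (forall x, 0 <= x <= 1 -> continuous q0 x /\ continuous q1 x /\ continuous q2 x) ->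
  (forall x, 0 < x < 1 ->
    is_derive p0 x (p1 x) /\ is_derive p1 x (p2 x) /\ is_derive p2 x (p3 x)) ->
  (forall x, 0 < x < 1 ->
    is_derive q0 x (q1 x) /\ is_derive q1 x (q2 x) /\ is_derive q2 x (q3 x)) ->
  p0 0 = 0 -> p1 0 = 0 -> q0 0 = 0 -> q1 0 = 0 ->
  (forall x, 0 < x < 1 ->
    repulsive_eq a b x (p0 x) (p1 x) (p2 x) (q0 x) (q1 x)) ->
  (forall x, 0 < x < 1 ->
    repulsive_eq a b x (q0 x) (q1 x) (q2 x) (- p0 x) (- p1 x)) ->
  forall x, 0 < x < 1 -> p0 x = 0 /\ q0 x = 0.
Proof.
intros Ha Cp Cq Dp Dq p00 p10 q00 q10 Ep Eq.
set (y1 := fun x => p1 x + 2 / x * p0 x).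
set (y2 := fun x => q1 x + 2 / x * q0 x).
set (z1 := fun x => p2 x + 2 / x * p1 x - 2 / x ^ 2 * p0 x).
set (z2 := fun x => q2 x + 2 / x * q1 x - 2 / x ^ 2 * q0 x).
set (w1 := fun x => p3 x + 2 / x * p2 x - 4 / x ^ 2 * p1 x + 4 / x ^ 3 * p0 x).
set (w2 := fun x => q3 x + 2 / x * q2 x - 4 / x ^ 2 * q1 x + 4 / x ^ 3 * q0 x).
set (G := fun x => energy a b x (p0 x) (q0 x) (y1 x) (y2 x) (z1 x) (z2 x)).
set (G' := fun x => dissipation a b x (p0 x) (q0 x) (y1 x) (y2 x) (z1 x) (z2 x)).
assert (Dy : forall (f0 f1 : R -> R) f2 x, 0 < x -> is_derive f0 x (f1 x) -> is_derive f1 x f2 ->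
  is_derive (fun r => f1 r + 2 / r * f0 r) x (f2 + 2 / x * f1 x - 2 / x ^ 2 * f0 x)).
{ intros f0 f1 f2 x Hx H0 H1. evar_last.
  { auto_derive; [repeat split; first [eexists; eassumption | lra] | reflexivity]. }
  rewrite_derivatives.
  field. lra. }
assert (Dz : forall (f0 f1 f2 : R -> R) f3 x, 0 < x -> is_derive f0 x (f1 x) ->
  is_derive f1 x (f2 x) -> is_derive f2 x f3 ->
  is_derive (fun r => f2 r + 2 / r * f1 r - 2 / r ^ 2 * f0 r) x
    (f3 + 2 / x * f2 x - 4 / x ^ 2 * f1 x + 4 / x ^ 3 * f0 x)).
{ intros f0 f1 f2 f3 x Hx H0 H1 H2. evar_last.
  { auto_derive; [repeat split;
      first [eexists; eassumption | lra | apply Rgt_not_eq; nra] | reflexivity]. }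
  rewrite_derivatives.
  field. lra. }
assert (DG : forall x, 0 < x < 1 -> is_derive G x (G' x)).
{ intros x Hx.
  destruct (Dp x Hx) as [Dp0 [Dp1 Dp2]], (Dq x Hx) as [Dq0 [Dq1 Dq2]].
  apply is_derive_energy with (w1 := w1 x) (w2 := w2 x); try lra.
  - replace (_ - _) with (p1 x) by (unfold y1; ring). exact Dp0.
  - replace (_ - _) with (q1 x) by (unfold y2; ring). exact Dq0.
  - apply Dy; auto; lra.
  - apply Dy; auto; lra.
  - apply Dz; auto; lra.
  - apply Dz; auto; lra.
  - now apply intertwined_eq.
  - pose proof (intertwined_eq a b q0 q1 q2 q3 (fun r => - p0 r) (fun r => - p1 r)
      (fun r => - p2 r) x Hx Dq0 Dq1 Dq2 (is_derive_opp _ _ _ Dp0) (is_derive_opp _ _ _ Dp1) Eq)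
      as E.
    unfold w2, z1, z2, y1, y2. rewrite E. ring. }
assert (HG' : forall x, 0 < x < 1 -> p0 x ^ 2 + q0 x ^ 2 <= 4 * (1 + 2 * a) * G' x).
{ intros x Hx.
  now apply dissipation_bound. }
assert (G'_pos : forall x, 0 < x < 1 -> 0 <= G' x).
{ intros x Hx. specialize (HG' x Hx). nra. }
assert (CG : forall x, 0 < x <= 1 -> continuous G x).
{ intros x Hx.
  destruct (Cp x) as [Cp0 [Cp1 Cp2]], (Cq x) as [Cq0 [Cq1 Cq2]]; try lra.
  apply continuous_energy; try lra; auto;
  [unfold y1 | unfold y2 | unfold z1 | unfold z2]; simpl pow; prove_continuous;
  apply Rgt_not_eq; nra. }
assert (Gle : forall x y, 0 < x <= y -> y <= 1 -> G x <= G y).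
{ intros x y Hx Hy. apply nondecreasing_of_derive with (f' := G'); try lra.
  - intros r Hr. split; [apply DG | apply G'_pos]; lra.
  - intros r Hr. apply CG. lra. }
destruct (bounded_unit p2) as [Mp Hp]; [now intros; apply Cp|].
destruct (bounded_unit q2) as [Mq Hq]; [now intros; apply Cq|].
(* Integrating from 0 gives [|f1| <= M x] and [|f0| <= M x^2]. The constant [5 = 1 + 2 + 2] comes
   from the third expression. *)
assert (bound : forall (f0 f1 f2 : R -> R) M,
  (forall x, 0 <= x <= 1 -> continuous f0 x /\ continuous f1 x /\ continuous f2 x) ->
  (forall x, 0 < x < 1 -> is_derive f0 x (f1 x) /\ is_derive f1 x (f2 x)) ->
  f0 0 = 0 -> f1 0 = 0 -> (forall x, 0 <= x <= 1 -> Rabs (f2 x) <= M) ->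
  forall x, 0 < x < 1 ->
   Rabs (f0 x) <= 5 * M * x /\ Rabs (f1 x + 2 / x * f0 x) <= 5 * M * x
   /\ Rabs (f2 x + 2 / x * f1 x - 2 / x ^ 2 * f0 x) <= 5 * M).
{ intros f0 f1 f2 M C D f00 f10 HM x Hx.
  assert (B1 : forall r, 0 <= r <= 1 -> Rabs (f1 r) <= M * r).
  { intros r Hr. apply le_of_derive_bound with (f' := f2);
    [lra | assumption | now intros; apply D | now intros; apply C | intros; apply HM; lra]. }
  assert (Hf1 := B1 x ltac:(lra)).
  assert (Hf0 : Rabs (f0 x) <= M * x * x).
  { apply le_of_derive_bound with (f' := f1);
    [lra | assumption | now intros; apply D | now intros; apply C |].
    intros r Hr. apply Rle_trans with (M * r); [apply B1; lra|].
    apply Rmult_le_compat_l; [|lra].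
    apply Rle_trans with (Rabs (f2 x)); [apply Rabs_pos | apply HM; lra]. }
  assert (Hf2 := HM x ltac:(lra)).
  pose proof (Rabs_pos (f2 x)).
  assert (H2 : Rabs (2 / x * f0 x) <= 2 * M * x).
  { rewrite Rabs_mult, (Rabs_pos_eq (2 / x)) by (apply Rdiv_le_0_compat; lra).
    replace (2 * M * x) with (2 / x * (M * x * x)) by (field; lra).
    apply Rmult_le_compat_l; [apply Rdiv_le_0_compat; lra | lra]. }
  assert (H3 : Rabs (2 / x * f1 x) <= 2 * M).
  { rewrite Rabs_mult, (Rabs_pos_eq (2 / x)) by (apply Rdiv_le_0_compat; lra).
    replace (2 * M) with (2 / x * (M * x)) by (field; lra).
    apply Rmult_le_compat_l; [apply Rdiv_le_0_compat; lra | lra]. }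
  assert (H4 : Rabs (2 / x ^ 2 * f0 x) <= 2 * M).
  { rewrite Rabs_mult, (Rabs_pos_eq (2 / x ^ 2)) by (apply Rdiv_le_0_compat; nra).
    replace (2 * M) with (2 / x ^ 2 * (M * x * x)) by (field; lra).
    apply Rmult_le_compat_l; [apply Rdiv_le_0_compat; nra | lra]. }
  assert (0 <= M * x) by nra.
  repeat split; apply Rabs_le_between in Hf0, Hf1, Hf2, H2, H3, H4; apply Rabs_le_between; nra. }
assert (Gpos : forall x, 0 < x < 1 -> 0 <= G x).
{ intros x Hx.
  set (M := 5 * Rmax Mp Mq).
  set (K := (7 + Rabs b) ^ 2 * M ^ 2).
  assert (near0 : forall r, 0 < r < 1 -> - K * r <= G r).
  { intros r Hr.
    destruct (bound p0 p1 p2 (Rmax Mp Mq)) with (x := r) as [Bp0 [By1 Bz1]]; auto.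
    { intros; split; now apply Dp. }
    { intros; apply Rle_trans with Mp; [auto | apply Rmax_l]. }
    destruct (bound q0 q1 q2 (Rmax Mp Mq)) with (x := r) as [Bq0 [By2 Bz2]]; auto.
    { intros; split; now apply Dq. }
    { intros; apply Rle_trans with Mq; [auto | apply Rmax_r]. }
    replace (- K * r) with (- (7 + Rabs b) ^ 2 * M ^ 2 * r) by (unfold K; ring).
    now apply energy_near_0. }
  assert (HK : 0 <= K) by (unfold K; apply Rmult_le_pos; apply pow2_ge_0).
  apply Rnot_lt_le. intros Hneg.
  (* For this [r], [near0] gives [G r >= - K * r >= G x / 2 > G x], against monotonicity; [K + 1]
     keeps the denominator positive when [K = 0]. *)
  set (r := Rmin x (- G x / (2 * (K + 1)))).
  assert (Hr1 : r <= x) by apply Rmin_l.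
  assert (Hr2 : r <= - G x / (2 * (K + 1))) by apply Rmin_r.
  assert (Hr0 : 0 < r) by (apply Rmin_glb_lt; [lra | apply Rdiv_lt_0_compat; lra]).
  specialize (near0 r ltac:(lra)). specialize (Gle r x ltac:(lra) ltac:(lra)).
  apply Rle_div_r in Hr2; [|lra]. nra. }
assert (G0 : forall x, 0 < x < 1 -> G x = 0).
{ intros x Hx. apply Rle_antisym; [|now apply Gpos].
  apply Rle_trans with (G 1); [apply Gle; lra|]. apply energy_at_1. lra. }
intros x Hx.
assert (H : G' x = 0) by exact (is_derive_zero G x _ Hx G0 (DG x Hx)).
specialize (HG' x Hx). rewrite H, Rmult_0_r in HG'. split; nra.
Qed.

(** Both [f] and [- f] are nondecreasing up to the endpoints, so [f] is constant on [0,1]. *)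
Lemma zero_on_closure (f : R -> R) :
  (forall x, 0 <= x <= 1 -> continuous f x) -> (forall x, 0 < x < 1 -> f x = 0) ->
  forall x, 0 <= x <= 1 -> f x = 0.
Proof.
intros Hc H0.
assert (D : forall r, 0 < r < 1 -> is_derive f r 0 /\ is_derive (fun r => - f r) r 0).
{ intros r Hr.
  assert (D : is_derive f r 0).
  { apply (is_derive_ext_loc (fun _ => 0)); [|apply (is_derive_const 0 r)].
    apply (locally_interval _ r 0 1); simpl; try lra.
    intros y Hy0 Hy1. symmetry. now apply H0. }
  split; [exact D|].
  rewrite <- Ropp_0. now apply (is_derive_opp f r 0). }
assert (Hinc : forall x y, 0 <= x <= y -> y <= 1 -> f x = f y).
{ intros x y Hx Hy. apply Rle_antisym.
  - apply nondecreasing_of_derive with (f' := fun _ => 0); [lra| |intros; apply Hc; lra].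
    intros r Hr. split; [apply D|]; lra.
  - apply Ropp_le_cancel, (nondecreasing_of_derive (fun r => - f r) (fun _ => 0)); [lra| |].
    + intros r Hr. split; [apply D|]; lra.
    + intros r Hr. apply (continuous_opp (V := R_NormedModule)), Hc. lra. }
intros x Hx. specialize (H0 (1 / 2) ltac:(lra)).
destruct (Rle_lt_dec x (1 / 2)).
- rewrite (Hinc x (1 / 2)); lra.
- rewrite <- (Hinc (1 / 2) x); lra.
Qed.

(** * The Darboux transformation from [u] to [v] *)

(* The real part of the mode equation for [u + i w], with [V] split into partial fractions;
   [(w, - u)] gives the imaginary part. *)
Definition mode_eq (a b x u0 u1 u2 w0 w1 : R) : Prop :=
  - (1 - x ^ 2) * u2 - 2 * ((1 - x ^ 2) / x) * u1 + 2 * x * (a * u1 - b * w1)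
  + ((a ^ 2 - b ^ 2 + a) * u0 - (2 * a * b + b) * w0)
  + (2 / x ^ 2 - 16 / (1 + x ^ 2) ^ 2) * u0 = 0.

(* The real part of [v]; [darboux1] and [darboux2] are its derivatives. *)
Definition darboux (a b x u0 u1 w0 : R) : R :=
  x * (1 - x ^ 2) * u1 + (3 - x ^ 2 - 4 / (1 + x ^ 2)) * u0
  + x ^ 2 * ((1 - a) * u0 + b * w0).

Definition darboux1 (a b x u0 u1 u2 w0 w1 : R) : R :=
  x * (1 - x ^ 2) * u2 + (4 - 4 * x ^ 2 - 4 / (1 + x ^ 2)) * u1
  + (8 * x / (1 + x ^ 2) ^ 2 - 2 * x) * u0
  + x ^ 2 * ((1 - a) * u1 + b * w1) + 2 * x * ((1 - a) * u0 + b * w0).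

Definition darboux2 (a b x u0 u1 u2 u3 w0 w1 w2 : R) : R :=
  x * (1 - x ^ 2) * u3 + (5 - 7 * x ^ 2 - 4 / (1 + x ^ 2)) * u2
  + (16 * x / (1 + x ^ 2) ^ 2 - 10 * x) * u1
  + (8 / (1 + x ^ 2) ^ 2 - 32 * x ^ 2 / (1 + x ^ 2) ^ 3 - 2) * u0
  + x ^ 2 * ((1 - a) * u2 + b * w2) + 4 * x * ((1 - a) * u1 + b * w1)
  + 2 * ((1 - a) * u0 + b * w0).

Lemma is_derive_darboux (a b x : R) (u0 u1 u2 w0 w1 : R -> R) :
  is_derive u0 x (u1 x) -> is_derive u1 x (u2 x) -> is_derive w0 x (w1 x) ->
  is_derive (fun r => darboux a b r (u0 r) (u1 r) (w0 r)) x
    (darboux1 a b x (u0 x) (u1 x) (u2 x) (w0 x) (w1 x)).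
Proof.
intros Hu0 Hu1 Hw0. unfold darboux, darboux1.
evar_last.
{ auto_derive; [repeat split;
    first [eexists; eassumption | apply Rgt_not_eq; nra] | reflexivity]. }
rewrite_derivatives.
field. nra.
Qed.

Lemma is_derive_darboux1 (a b x : R) (u0 u1 u2 u3 w0 w1 w2 : R -> R) :
  is_derive u0 x (u1 x) -> is_derive u1 x (u2 x) -> is_derive u2 x (u3 x) ->
  is_derive w0 x (w1 x) -> is_derive w1 x (w2 x) ->
  is_derive (fun r => darboux1 a b r (u0 r) (u1 r) (u2 r) (w0 r) (w1 r)) x
    (darboux2 a b x (u0 x) (u1 x) (u2 x) (u3 x) (w0 x) (w1 x) (w2 x)).
Proof.
intros Hu0 Hu1 Hu2 Hw0 Hw1. unfold darboux1, darboux2.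
evar_last.
{ auto_derive; [repeat split;
    first [eexists; eassumption | apply Rgt_not_eq; nra] | reflexivity]. }
rewrite_derivatives.
field. nra.
Qed.

Lemma ex_derive_darboux2 (a b x : R) (u0 u1 u2 u3 w0 w1 w2 : R -> R) :
  ex_derive u0 x -> ex_derive u1 x -> ex_derive u2 x -> ex_derive u3 x ->
  ex_derive w0 x -> ex_derive w1 x -> ex_derive w2 x ->
  ex_derive (fun r => darboux2 a b r (u0 r) (u1 r) (u2 r) (u3 r) (w0 r) (w1 r) (w2 r)) x.
Proof.
intros. unfold darboux2.
auto_derive. repeat split; first [eassumption | apply Rgt_not_eq; nra].
Qed.

Lemma darboux_intertwines (a b : R) (u0 u1 u2 u3 w0 w1 w2 : R -> R) (x : R) :
  0 < x < 1 ->
  is_derive u0 x (u1 x) -> is_derive u1 x (u2 x) -> is_derive u2 x (u3 x) ->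
  is_derive w0 x (w1 x) -> is_derive w1 x (w2 x) ->
  (forall r, 0 < r < 1 -> mode_eq a b r (u0 r) (u1 r) (u2 r) (w0 r) (w1 r)) ->
  mode_eq a b x (w0 x) (w1 x) (w2 x) (- u0 x) (- u1 x) ->
  repulsive_eq a b x
    (darboux a b x (u0 x) (u1 x) (w0 x))
    (darboux1 a b x (u0 x) (u1 x) (u2 x) (w0 x) (w1 x))
    (darboux2 a b x (u0 x) (u1 x) (u2 x) (u3 x) (w0 x) (w1 x) (w2 x))
    (darboux a b x (w0 x) (w1 x) (- u0 x))
    (darboux1 a b x (w0 x) (w1 x) (w2 x) (- u0 x) (- u1 x)).
Proof.
intros Hx Hu0 Hu1 Hu2 Hw0 Hw1 Eu Ew.
assert (E' : - (1 - x ^ 2) * u3 x + 2 * x * u2 x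
   - 2 * ((1 - x ^ 2) / x) * u2 x + 2 * (1 / x ^ 2 + 1) * u1 x
   + 2 * (a * u1 x - b * w1 x) + 2 * x * (a * u2 x - b * w2 x)
   + ((a ^ 2 - b ^ 2 + a) * u1 x - (2 * a * b + b) * w1 x)
   + (2 / x ^ 2 - 16 / (1 + x ^ 2) ^ 2) * u1 x
   + (64 * x / (1 + x ^ 2) ^ 3 - 4 / x ^ 3) * u0 x = 0).
{ apply (is_derive_zero _ x _ Hx Eu).
  evar_last.
  { auto_derive; [repeat split;
      first [eexists; eassumption | apply Rgt_not_eq; nra] | reflexivity]. }
  rewrite_derivatives.
  field. split; nra. }
specialize (Eu x Hx). unfold mode_eq in Eu, Ew.
unfold repulsive_eq, darboux, darboux1, darboux2.
(* The transformed equation is [x (1 - t)] times the derivative of the original one plus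
   [3 - 2 t - 4 / (1 + t) - lam t] times the original one. *)
set (alpha := 3 - x ^ 2 - 4 / (1 + x ^ 2) - x ^ 2 - a * x ^ 2).
pose proof (f_equal2 Rplus (f_equal (Rmult (x * (1 - x ^ 2))) E')
  (f_equal2 Rplus (f_equal (Rmult alpha) Eu) (f_equal (Rmult (b * x ^ 2)) Ew))) as H.
etransitivity; [|etransitivity; [exact H|ring]].
unfold alpha. field. split; nra.
Qed.

(* The conclusion is the real part of [(1 - lam) ^ 2 (u0 + i w0) = 0]. *)
Lemma darboux_kernel (a b x u0 u1 u2 w0 w1 : R) :
  0 < x < 1 -> mode_eq a b x u0 u1 u2 w0 w1 ->
  darboux a b x u0 u1 w0 = 0 -> darboux a b x w0 w1 (- u0) = 0 ->
  darboux1 a b x u0 u1 u2 w0 w1 = 0 ->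
  ((1 - a) ^ 2 - b ^ 2) * u0 + 2 * (1 - a) * b * w0 = 0.
Proof.
intros Hx E P Q P1.
apply (Rmult_eq_reg_l (x ^ 2)); [|nra].
(* [P] and [Q] are the real and imaginary parts of [v = 0] and enter through the real part of
   [- (2 - t - 4 / (1 + t) + lam t) v]. With these multipliers [u''] and [u'] cancel and
   [t (1 - lam)^2 u] remains. *)
pose proof (f_equal2 Rplus (f_equal (Rmult (x * (1 - x ^ 2))) P1)
  (f_equal2 Rplus (f_equal (Rmult (x ^ 2 * (1 - x ^ 2))) E)
    (f_equal2 Rplus (f_equal (Rmult (- (2 - x ^ 2 - 4 / (1 + x ^ 2) + a * x ^ 2))) P)
      (f_equal (Rmult (b * x ^ 2)) Q)))) as H.
etransitivity; [|etransitivity; [exact H|ring]].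
unfold darboux, darboux1. field. split; nra.
Qed.

Lemma continuous_darboux (a b x : R) (u0 u1 w0 : R -> R) :
  continuous u0 x -> continuous u1 x -> continuous w0 x ->
  continuous (fun r => darboux a b r (u0 r) (u1 r) (w0 r)) x.
Proof.
intros. unfold darboux; simpl pow. prove_continuous.
apply Rgt_not_eq; nra.
Qed.

Lemma continuous_darboux1 (a b x : R) (u0 u1 u2 w0 w1 : R -> R) :
  continuous u0 x -> continuous u1 x -> continuous u2 x ->
  continuous w0 x -> continuous w1 x ->
  continuous (fun r => darboux1 a b r (u0 r) (u1 r) (u2 r) (w0 r) (w1 r)) x.
Proof.
intros. unfold darboux1; simpl pow.
prove_continuous; apply Rgt_not_eq; repeat apply Rmult_lt_0_compat; nra.
Qed.

Lemma continuous_darboux2 (a b x : R) (u0 u1 u2 u3 w0 w1 w2 : R -> R) :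
  continuous u0 x -> continuous u1 x -> continuous u2 x -> continuous u3 x ->
  continuous w0 x -> continuous w1 x -> continuous w2 x ->
  continuous (fun r => darboux2 a b r (u0 r) (u1 r) (u2 r) (u3 r) (w0 r) (w1 r) (w2 r)) x.
Proof.
intros. unfold darboux2; simpl pow.
prove_continuous; apply Rgt_not_eq; repeat apply Rmult_lt_0_compat; nra.
Qed.

(** * Vanishing of [u] *)

(** Multiplied by [x ^ 2], the equation has continuous coefficients and persists at 0, where it
    reads [2 * u0 0 = 0]. *)
Lemma mode_eq_value_at_0 (a b : R) (u0 u1 u2 w0 w1 : R -> R) :
  (forall x, 0 <= x <= 1 -> continuous u0 x /\ continuous u1 x /\ continuous u2 x) ->
  (forall x, 0 <= x <= 1 -> continuous w0 x /\ continuous w1 x) ->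
  (forall x, 0 < x < 1 -> mode_eq a b x (u0 x) (u1 x) (u2 x) (w0 x) (w1 x)) ->
  u0 0 = 0.
Proof.
intros Cu Cw E.
set (f := fun x => - (x ^ 2 * (1 - x ^ 2)) * u2 x - 2 * x * (1 - x ^ 2) * u1 x
  + 2 * x ^ 3 * (a * u1 x - b * w1 x)
  + x ^ 2 * ((a ^ 2 - b ^ 2 + a) * u0 x - (2 * a * b + b) * w0 x)
  + (2 - 16 * x ^ 2 / (1 + x ^ 2) ^ 2) * u0 x).
assert (Hf : f 0 = 0).
{ apply zero_on_closure; [| |lra].
  - intros x Hx.
    destruct (Cu x Hx) as [Cu0 [Cu1 Cu2]], (Cw x Hx) as [Cw0 Cw1].
    unfold f; simpl pow. prove_continuous.
    apply Rgt_not_eq; nra.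
  - intros x Hx. specialize (E x Hx). unfold mode_eq in E.
    rewrite <- (Rmult_0_r (x ^ 2)), <- E. unfold f. field. split; nra. }
replace (u0 0) with (f 0 / 2) by (unfold f; field).
rewrite Hf. field.
Qed.

Lemma mode_trivial (a b : R) (u w : nat -> R -> R) :
  0 <= a <= 1 / 2 ->
  (forall n x, 0 <= x <= 1 -> continuous (u n) x) ->
  (forall n x, 0 <= x <= 1 -> continuous (w n) x) ->
  (forall n x, 0 < x < 1 -> is_derive (u n) x (u (S n) x)) ->
  (forall n x, 0 < x < 1 -> is_derive (w n) x (w (S n) x)) ->
  (forall x, 0 < x < 1 ->
    mode_eq a b x (u 0%nat x) (u 1%nat x) (u 2%nat x) (w 0%nat x) (w 1%nat x)) ->
  (forall x, 0 < x < 1 ->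
    mode_eq a b x (w 0%nat x) (w 1%nat x) (w 2%nat x) (- u 0%nat x) (- u 1%nat x)) ->
  forall x, 0 <= x <= 1 -> u 0%nat x = 0 /\ w 0%nat x = 0.
Proof.
intros Ha Cu Cw Du Dw Eu Ew.
set (nu := fun n r => - u n r).
assert (Cnu : forall n x, 0 <= x <= 1 -> continuous (nu n) x).
{ intros n x Hx. now apply (continuous_opp (V := R_NormedModule)), Cu. }
assert (Dnu : forall n x, 0 < x < 1 -> is_derive (nu n) x (nu (S n) x)).
{ intros n x Hx. now apply (is_derive_opp (u n)), Du. }
assert (u00 : u 0%nat 0 = 0).
{ now apply (mode_eq_value_at_0 a b (u 0%nat) (u 1%nat) (u 2%nat) (w 0%nat) (w 1%nat)); auto. }
assert (w00 : w 0%nat 0 = 0).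
{ now apply (mode_eq_value_at_0 a b (w 0%nat) (w 1%nat) (w 2%nat) (nu 0%nat) (nu 1%nat)); auto. }
set (p0 := fun r => darboux a b r (u 0%nat r) (u 1%nat r) (w 0%nat r)).
set (p1 := fun r => darboux1 a b r (u 0%nat r) (u 1%nat r) (u 2%nat r) (w 0%nat r) (w 1%nat r)).
set (p2 := fun r => darboux2 a b r (u 0%nat r) (u 1%nat r) (u 2%nat r) (u 3%nat r)
                      (w 0%nat r) (w 1%nat r) (w 2%nat r)).
set (q0 := fun r => darboux a b r (w 0%nat r) (w 1%nat r) (nu 0%nat r)).
set (q1 := fun r => darboux1 a b r (w 0%nat r) (w 1%nat r) (w 2%nat r) (nu 0%nat r) (nu 1%nat r)).
set (q2 := fun r => darboux2 a b r (w 0%nat r) (w 1%nat r) (w 2%nat r) (w 3%nat r)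
                      (nu 0%nat r) (nu 1%nat r) (nu 2%nat r)).
assert (Dp : forall x, 0 < x < 1 -> is_derive p0 x (p1 x) /\ is_derive p1 x (p2 x)
             /\ is_derive p2 x (Derive p2 x)).
{ intros x Hx. split; [|split].
  - apply is_derive_darboux; auto.
  - apply is_derive_darboux1; auto.
  - apply Derive_correct, ex_derive_darboux2; eexists; eauto. }
assert (Dq : forall x, 0 < x < 1 -> is_derive q0 x (q1 x) /\ is_derive q1 x (q2 x)
             /\ is_derive q2 x (Derive q2 x)).
{ intros x Hx. split; [|split].
  - apply is_derive_darboux; auto.
  - apply is_derive_darboux1; auto.
  - apply Derive_correct, ex_derive_darboux2; eexists; eauto. }
assert (Enu : forall x, 0 < x < 1 ->
  mode_eq a b x (nu 0%nat x) (nu 1%nat x) (nu 2%nat x) (- w 0%nat x) (- w 1%nat x)).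
{ intros x Hx. specialize (Eu x Hx). unfold mode_eq, nu in *.
  rewrite <- Ropp_0, <- Eu. ring. }
assert (Z : forall x, 0 < x < 1 -> p0 x = 0 /\ q0 x = 0).
{ apply (repulsive_mode_trivial a b p0 p1 p2 (Derive p2) q0 q1 q2 (Derive q2)); auto.
  - intros x Hx. split; [|split].
    + apply continuous_darboux; auto.
    + apply continuous_darboux1; auto.
    + apply continuous_darboux2; auto.
  - intros x Hx. split; [|split].
    + apply continuous_darboux; auto.
    + apply continuous_darboux1; auto.
    + apply continuous_darboux2; auto.
  (* At 0, [v] reduces to [- u], and in [v'] the coefficient [4 - 4] of [u'] vanishes. *)
  - unfold p0, darboux. rewrite u00. field.
  - unfold p1, darboux1. rewrite u00. field.
  - unfold q0, darboux. rewrite w00. field.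
  - unfold q1, darboux1. rewrite w00. field.
  - intros x Hx. apply darboux_intertwines; auto.
  - intros x Hx.
    replace (- p0 x) with (darboux a b x (nu 0%nat x) (nu 1%nat x) (- w 0%nat x))
      by (unfold p0, darboux, nu; ring).
    replace (- p1 x) with (darboux1 a b x (nu 0%nat x) (nu 1%nat x) (nu 2%nat x)
                             (- w 0%nat x) (- w 1%nat x))
      by (unfold p1, darboux1, nu; ring).
    apply darboux_intertwines; auto. }
assert (Z' : forall x, 0 < x < 1 -> u 0%nat x = 0 /\ w 0%nat x = 0).
{ intros x Hx. destruct (Z x Hx) as [P0 Q0].
  assert (P1 : p1 x = 0).
  { apply (is_derive_zero p0 x); auto. now apply Z. now apply Dp. }
  assert (Q1 : q1 x = 0).
  { apply (is_derive_zero q0 x); auto. now apply Z. now apply Dq. }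
  pose proof (darboux_kernel a b x _ _ _ _ _ Hx (Eu x Hx) P0 Q0 P1) as K1.
  assert (P0' : darboux a b x (nu 0%nat x) (nu 1%nat x) (- w 0%nat x) = 0).
  { rewrite <- Ropp_0, <- P0. unfold p0, darboux, nu. ring. }
  pose proof (darboux_kernel a b x _ _ _ _ _ Hx (Ew x Hx) Q0 P0' Q1) as K2.
  set (c := (1 - a) ^ 2 - b ^ 2) in *. set (d := 2 * (1 - a) * b) in *.
  (* Here [c - i d = (1 - lam)^2], which is nonzero because [a <= 1 / 2]. The two combinations below
     multiply [K1 + i K2] by the conjugate [c + i d]. *)
  assert (Hcd : c ^ 2 + d ^ 2 <> 0).
  { replace (c ^ 2 + d ^ 2) with (((1 - a) ^ 2 + b ^ 2) ^ 2) by (unfold c, d; ring).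
    apply pow_nonzero. nra. }
  split; apply (Rmult_eq_reg_l (c ^ 2 + d ^ 2)); auto; rewrite Rmult_0_r.
  - transitivity (c * (c * u 0%nat x + d * w 0%nat x)
      - d * (c * w 0%nat x + d * - u 0%nat x)); [ring|]. rewrite K1, K2. ring.
  - transitivity (d * (c * u 0%nat x + d * w 0%nat x)
      + c * (c * w 0%nat x + d * - u 0%nat x)); [ring|]. rewrite K1, K2. ring. }
intros x Hx.
split; apply (zero_on_closure _); auto; intros; now apply Z'.
Qed.

(** * From one-sided smoothness to chains of real derivatives *)

(* [smooth01] says nothing about values outside [0,1]; composing with [clamp] makes the one-sided
   continuity at the endpoints two-sided. *)
Definition clamp (x : R) : R := Rmax 0 (Rmin 1 x).

Lemma clamp_unit (x : R) : unit_interval (clamp x).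
Proof.
unfold clamp, unit_interval.
split; [apply Rmax_l | apply Rmax_lub; [lra | apply Rmin_l]].
Qed.

Lemma clamp_id (x : R) : unit_interval x -> clamp x = x.
Proof.
unfold clamp, unit_interval. intros Hx. now rewrite Rmin_right, Rmax_right by lra.
Qed.

Lemma clamp_lipschitz (x y : R) : Rabs (clamp x - clamp y) <= Rabs (x - y).
Proof.
unfold clamp, Rmax, Rmin.
repeat destruct Rle_dec; unfold Rabs; repeat destruct Rcase_abs; lra.
Qed.

(** [0,1] is a neighbourhood of an interior point, so the relative derivative is a full one there;
    the real and imaginary parts follow by composition with linear projections. *)
Lemma is_derive01_interior (f : R -> C) (x : R) (l : C) :
  0 < x < 1 -> is_derive01 f x l ->
  is_derive (fun r => Re (f r)) x (Re l) /\ is_derive (fun r => Im (f r)) x (Im l).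
Proof.
intros Hx [Hl Hd].
assert (D : @filterdiff R_AbsRing R_NormedModule C_R_NormedModule f (locally x)
              (fun y : R => scal y l)).
{ split; [exact Hl|].
  intros x' Hx' eps.
  assert (H := Hd x' (fun P HP => filter_le_within _ _ (Hx' P HP)) eps).
  assert (Hu : locally x unit_interval).
  { apply (locally_interval _ x 0 1); simpl; try lra.
    intros y Hy0 Hy1. unfold unit_interval. lra. }
  unfold within in H.
  generalize (filter_and (F := locally x) _ _ H Hu). apply filter_imp.
  intros y [Hy1 Hy2]. now apply Hy1. }
split.
- exact (filterdiff_comp f fst _ _ D (filterdiff_linear _ is_linear_fst)).
- exact (filterdiff_comp f snd _ _ D (filterdiff_linear _ is_linear_snd)).
Qed.

(** [clamp] is 1-Lipschitz, takes values in [0,1] and fixes [x], so it carries full neighbourhoods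
    of [x] to relative ones. *)
Lemma is_derive01_continuous_clamp (f : R -> C) (x : R) (l : C) :
  unit_interval x -> is_derive01 f x l ->
  continuous (fun r => Re (f (clamp r))) x /\ continuous (fun r => Im (f (clamp r))) x.
Proof.
intros Hx Hd.
assert (Hlim : filterlim (fun r => f (clamp r)) (locally x) (locally (f x))).
{ apply filterlim_comp with (G := within unit_interval (locally x)).
  - intros P [d Hd'].
    exists d. intros y Hy. apply Hd'; [|apply clamp_unit].
    change (Rabs (clamp y - x) < d).
    rewrite <- (clamp_id x Hx). apply Rle_lt_trans with (1 := clamp_lipschitz y x), Hy.
  - apply (filterdiff_continuous_aux f); [now eexists; apply Hd|].
    intros P HP. now apply filter_le_within. }
unfold continuous. rewrite (clamp_id x Hx).
destruct (f x) as [f1 f2].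
split.
- apply filterlim_comp with (1 := Hlim).
  apply (continuous_fst (U := R_UniformSpace) (V := R_UniformSpace)).
- apply filterlim_comp with (1 := Hlim).
  apply (continuous_snd (U := R_UniformSpace) (V := R_UniformSpace)).
Qed.

Lemma smooth01_chain (f : R -> C) :
  smooth01 f -> exists u w : nat -> R -> R,
    (forall x, unit_interval x -> f x = (u 0%nat x, w 0%nat x)) /\
    (forall n x, 0 <= x <= 1 -> continuous (u n) x) /\
    (forall n x, 0 <= x <= 1 -> continuous (w n) x) /\
    (forall n x, 0 < x < 1 -> is_derive (u n) x (u (S n) x)) /\
    (forall n x, 0 < x < 1 -> is_derive (w n) x (w (S n) x)).
Proof.
intros [D [D0 DS]].
exists (fun n x => Re (D n (clamp x))), (fun n x => Im (D n (clamp x))).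
assert (Hder : forall n x, 0 < x < 1 ->
  is_derive (fun r => Re (D n (clamp r))) x (Re (D (S n) (clamp x))) /\
  is_derive (fun r => Im (D n (clamp r))) x (Im (D (S n) (clamp x)))).
{ intros n x Hx.
  assert (Hux : unit_interval x) by (unfold unit_interval; lra).
  destruct (is_derive01_interior (D n) x _ Hx (DS n x Hux)) as [HR HI].
  assert (Hloc : locally x (fun y => clamp y = y)).
  { apply (locally_interval _ x 0 1); simpl; try lra.
    intros y Hy0 Hy1. apply clamp_id. unfold unit_interval. lra. }
  rewrite (clamp_id x Hux).
  split; [apply (is_derive_ext_loc (fun r => Re (D n r)))
        | apply (is_derive_ext_loc (fun r => Im (D n r)))];
    auto; generalize Hloc; apply filter_imp; intros y Hy; now rewrite Hy. }
split; [|split; [|split; [|split]]]; intros.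
- rewrite (clamp_id x H), (D0 x H). apply surjective_pairing.
- now apply (is_derive01_continuous_clamp (D n) x (D (S n) x)), DS.
- now apply (is_derive01_continuous_clamp (D n) x (D (S n) x)), DS.
- now apply Hder.
- now apply Hder.
Qed.

Lemma Derive_n_chain (f : R -> R) (u : nat -> R -> R) (x : R) :
  0 < x < 1 ->
  (forall y, 0 < y < 1 -> f y = u 0%nat y) ->
  (forall n y, 0 < y < 1 -> is_derive (u n) y (u (S n) y)) ->
  forall n, Derive_n f n x = u n x.
Proof.
intros Hx Hf Du n. revert x Hx.
induction n as [|n IH]; intros x Hx; [now apply Hf|].
simpl. rewrite <- (is_derive_unique _ _ _ (Du n x Hx)).
apply Derive_ext_loc, (locally_interval _ x 0 1); simpl; try lra.
intros y Hy0 Hy1. now apply IH.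
Qed.

Theorem theorem1p3 (lam : C)
  (hRe : 0 <= Re lam <= 1 / 2) (hIm : Rabs (Im lam) <= 10) :
  ~ exists u : R -> C, unstable_mode lam u.
Proof.
intros [f [_ [Hs [[x0 [Hx0 Hnz]] Hm]]]].
destruct (smooth01_chain f Hs) as [u [w [Hf [Cu [Cw [Du Dw]]]]]].
destruct lam as [a b]. simpl in hRe.
assert (E : forall x, 0 < x < 1 ->
  mode_eq a b x (u 0%nat x) (u 1%nat x) (u 2%nat x) (w 0%nat x) (w 1%nat x) /\
  mode_eq a b x (w 0%nat x) (w 1%nat x) (w 2%nat x) (- u 0%nat x) (- u 1%nat x)).
{ intros x Hx. specialize (Hm x Hx).
  assert (HR : forall y, 0 < y < 1 -> Re (f y) = u 0%nat y).
  { intros y Hy. now rewrite Hf by (unfold unit_interval; lra). }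
  assert (HI : forall y, 0 < y < 1 -> Im (f y) = w 0%nat y).
  { intros y Hy. now rewrite Hf by (unfold unit_interval; lra). }
  unfold mode_equation, CDerive_n in Hm.
  rewrite !(Derive_n_chain _ u x Hx HR Du), !(Derive_n_chain _ w x Hx HI Dw) in Hm.
  (* In rational form [V x / x ^ 2] equals [2 / x ^ 2 - 16 / (1 + x ^ 2) ^ 2], the potential of
     [mode_eq]. *)
  rewrite V_rational, Hf in Hm by (unfold unit_interval; lra).
  injection Hm as ER EI. simpl in ER, EI.
  unfold mode_eq. split.
  - rewrite <- ER. field. split; nra.
  - rewrite <- EI. field. split; nra. }
destruct (mode_trivial a b u w hRe Cu Cw Du Dw (fun x Hx => proj1 (E x Hx))
  (fun x Hx => proj2 (E x Hx)) x0 Hx0) as [Hu Hw].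
apply Hnz. now rewrite Hf, Hu, Hw.
Qed.
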